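(* Let $\mathcal{C}_5^1=\langle (x+1)^\alpha\rangle\subseteq\mathcal{S}$, where $1\le\alpha\le2^\varsigma-1$. Then, for every trace orthogonal basis $\mathcal{B}$ of $\mathbb{F}_{2^m}$ over $\mathbb{F}_2$, $$d_L^{\mathcal{B}}(\mathcal{C}_5^1)=\begin{cases}2 & \text{if } 1\le\alpha\le2^{\varsigma-1},\\ 2^{\gamma+1} & \text{if } 2^\varsigma-2^{\varsigma-\gamma}+1\le\alpha\le2^\varsigma-2^{\varsigma-\gamma}+2^{\varsigma-\gamma-1},\ \text{where } 1\le\gamma\le\varsigma-1.\end{cases}$$
   Context: Let $m,\varsigma$ be positive integers, $\mathcal{R}=\mathbb{F}_{2^m}+u\mathbb{F}_{2^m}+u^2\mathbb{F}_{2^m}$ with $u^3=0$ (i.e. $\mathbb{F}_{2^m}[u]/\langle u^3\rangle$), and $\mathcal{S}=\mathcal{R}[x]/\langle x^{2^\varsigma}-1\rangle$. Cyclic codes of length $2^\varsigma$ over $\mathcal{R}$ are the ideals of $\mathcal{S}$; the class of $c_0+c_1x+\cdots+c_{2^\varsigma-1}x^{2^\varsigma-1}$ is identified with $(c_0,\dots,c_{2^\varsigma-1})\in\mathcal{R}^{2^\varsigma}$. $\langle\cdot\rangle$ denotes the ideal of $\mathcal{S}$ generated. A trace orthogonal basis (TOB) of $\mathbb{F}_{2^m}$ over $\mathbb{F}_2$ is a basis $\mathcal{B}=\{\zeta_1,\dots,\zeta_m\}$ with $Tr(\zeta_i\zeta_j)=1$ if $i=j$ and $0$ if $i\ne j$,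 where $Tr(y)=y+y^2+y^{2^2}+\cdots+y^{2^{m-1}}$ (such bases exist). For $y=\sum_i y_i\zeta_i\in\mathbb{F}_{2^m}$ with $y_i\in\mathbb{F}_2$, $wt_L^{\mathcal{B}}(y)$ is the number of $i$ with $y_i=1$. For $a+ub+u^2c\in\mathcal{R}$ ($a,b,c\in\mathbb{F}_{2^m}$), $wt_L^{\mathcal{B}}(a+ub+u^2c)=wt_L^{\mathcal{B}}(a+b+c)+wt_L^{\mathcal{B}}(b+c)+wt_L^{\mathcal{B}}(b)$. The Lee weight of a vector (or polynomial of degree less than $2^\varsigma$) is the sum of the Lee weights of its entries (coefficients). The Lee distance $d_L^{\mathcal{B}}(\mathcal{C})$ of a nonzero code $\mathcal{C}$ is the minimum Lee weight of its nonzero elements. *)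

(* Defs.v *)
From HB Require Import structures.
From mathcomp Require Import all_boot all_order all_algebra all_field.

Set Implicit Arguments.
Unset Strict Implicit.
Unset Printing Implicit Defensive.

Import GRing.Theory.
Local Open Scope ring_scope.

(* The field F_{2^m} is a field extension F of 'F_2 such that \dim {:F} = m.  *)

(* F[u] / <u^3>; the element a + u b + u^2 c has coefficients r`_0 = a,
   r`_1 = b and r`_2 = c. *)
Notation chain_ring F := {poly %/ ('X^3 : {poly F})}.

(* R[x] / <x^n - 1>; an element s is represented by its unique representative of
   degree less than n, whose coefficients are s`_0, ..., s`_(n - 1).  The image
   of x is 'qX. *)
Notation cyclic_ring R n := {poly %/ ('X^n - 1 : {poly R})}.

(* {poly %/ h} silently replaces h by 'X unless h is monic and nonconstant; the
   next two facts exclude this for the moduli used here. *)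
Lemma mk_monic_chain (F : fieldType) : mk_monic ('X^3 : {poly F}) = 'X^3.
Proof. by rewrite /mk_monic size_polyXn monicXn. Qed.

Lemma mk_monic_cyclic (R : comNzRingType) (n : nat) :
  (0 < n)%N -> mk_monic ('X^n - 1 : {poly R}) = 'X^n - 1.
Proof.
by move=> n_gt0; rewrite /mk_monic -polyC1 size_XnsubC // ltnS n_gt0 monicXnsubC.
Qed.

Definition principal_ideal (A : comNzRingType) (g : A) : A -> Prop :=
  fun c => exists r, c = r * g.

Section LeeWeight.

Variables (F : fieldExtType 'F_2) (m : nat).

Definition abs_trace (y : F) : F := \sum_(i < m) y ^+ (2 ^ i).

Definition trace_orthogonal_basis (B : m.-tuple F) : Prop :=
  basis_of {:F} B /\
  forall i j : 'I_m, abs_trace (tnth B i * tnth B j) = (i == j)%:R.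

Definition lee_weight_field (B : m.-tuple F) (y : F) : nat :=
  #|[set i : 'I_m | coord B i y == 1]|.

Definition lee_weight (B : m.-tuple F) (r : chain_ring F) : nat :=
  (lee_weight_field B (r`_0 + r`_1 + r`_2)%R
   + lee_weight_field B (r`_1 + r`_2)%R
   + lee_weight_field B (r`_1)%R)%N.

Definition lee_weight_word (B : m.-tuple F) (n : nat)
    (s : cyclic_ring (chain_ring F) n) : nat :=
  (\sum_(i < n) lee_weight B (s`_i)%R)%N.

Definition is_lee_distance (B : m.-tuple F) (n : nat)
    (C : cyclic_ring (chain_ring F) n -> Prop) (d : nat) : Prop :=
  (exists s, [/\ C s, s != 0 & lee_weight_word B s = d]) /\
  (forall s, C s -> s != 0 -> (d <= lee_weight_word B s)%N).

End LeeWeight.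

(* Main.v *)
(* Every nonzero element of the chain ring has positive Lee weight, so the Lee
   weight of a word dominates its Hamming weight.  With N = 2^(s - 1), a nonzero
   polynomial f of degree below 2 N that is divisible by
   (x + 1)^(2^s - 2^(s - gamma) + 1) with 0 < gamma is p * (x^N + 1) for some p
   of degree below N; so f consists of two copies of p, and p satisfies the same
   hypothesis for s - 1 and gamma - 1.  By induction the Hamming weight of f is
   at least 2^(gamma + 1), starting from gamma = 0, where f(1) = 0 forces two
   nonzero coefficients.  The bound is attained by z (x + 1)^(2^s - 2^t) with
   t = s - gamma - 1 and z a basis vector of F, whose 2^(gamma + 1) nonzero
   coefficients all equal z, an element of Lee weight 1. *)

Require Import Defs.
From HB Require Import structures.
From mathcomp Require Import all_boot all_order all_algebra all_field.

Set Implicit Arguments.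
Unset Strict Implicit.
Unset Printing Implicit Defensive.

Import GRing.Theory.
Local Open Scope ring_scope.

Definition hamming_weight (R : nzRingType) (n : nat) (p : {poly R}) : nat :=
  (\sum_(i < n) (p`_i != 0)%R)%N.

Lemma horner1_sum (R : nzRingType) (n : nat) (p : {poly R}) :
  (size p <= n)%N -> p.[1] = \sum_(i < n) p`_i.
Proof.
move=> sp; rewrite (horner_coef_wide _ sp).
by apply: eq_bigr => i _; rewrite expr1n mulr1.
Qed.

(** The value at 1 is the sum of the coefficients, so a lone nonzero coefficient would equal
    [p.[1]]. *)
Lemma hamming_weight_ge2 (R : nzRingType) (n : nat) (p : {poly R}) :
  (size p <= n)%N -> p != 0 -> p.[1] = 0 -> (2 <= hamming_weight n p)%N.
Proof.
move=> sp p0 p1; have sp0 : (0 < size p)%N by rewrite size_poly_gt0.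
have ltpn : ((size p).-1 < n)%N by rewrite prednK.
pose i0 := Ordinal ltpn.
have pi0 : p`_i0 != 0 by rewrite -lead_coefE lead_coef_eq0.
rewrite /hamming_weight (bigD1 i0) //= pi0 ltnS lt0n.
apply: contraNneq pi0 => /eqP; rewrite sum_nat_eq0 => /forall_inP h.
move: p1; rewrite (horner1_sum sp) (bigD1 i0) //= big1 ?addr0 => [->//|i ni].
by have := h _ ni; rewrite eqb0 negbK => /eqP.
Qed.

Lemma in_qpolyK (R : nzRingType) (h : {poly R}) (c : {poly %/ h}) :
  in_qpoly h (polyn c) = c.
Proof. by apply: val_inj; apply: in_qpoly_small (size_mk_monic c). Qed.

Lemma size_mk_monic_cyclic (R : comNzRingType) (n : nat) :
  (0 < n)%N -> size (mk_monic ('X^n - 1 : {poly R})) = n.+1.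
Proof. by move=> n0; rewrite mk_monic_cyclic // -polyC1 size_XnsubC. Qed.

Lemma size_cyclic (R : comNzRingType) (n : nat) (c : cyclic_ring R n) :
  (0 < n)%N -> (size (polyn c) <= n)%N.
Proof.
by move=> n0; have := size_mk_monic c; rewrite {2}size_mk_monic_cyclic.
Qed.

Section CharacteristicTwo.

Variables (R : comNzRingType) (R2 : 2 \in [pchar R]).

Lemma exprXD1_pow2 (t : nat) : ('X + 1 : {poly R}) ^+ (2 ^ t) = 'X^(2 ^ t) + 1.
Proof.
have P2 : 2 \in [pchar {poly R}] by rewrite pchar_poly.
elim: t => [|t IH]; first by rewrite !expr1.
rewrite expnS mulnC !exprM IH -!(pFrobenius_autE P2).
by rewrite pFrobenius_autD_comm ?pFrobenius_aut1 //; apply: mulrC.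
Qed.

(** The copies [q] and [q * 'X^N] do not overlap, as [q] has degree below [N]. An arbitrary [phi]
    covers both the Hamming and the Lee weight. *)
Lemma sum_coef_mul_Xn_add1 (phi : R -> nat) (N : nat) (q : {poly R}) :
  (size q <= N)%N ->
  (\sum_(i < N + N) phi ((q * ('X^N + 1))`_i)%R
     = 2 * \sum_(i < N) phi (q`_i)%R)%N.
Proof.
move=> sq; rewrite big_split_ord /= mul2n -addnn; congr (_ + _)%N.
  by apply: eq_bigr => i _; rewrite mulrDr mulr1 coefD coefMXn ltn_ord add0r.
apply: eq_bigr => i _; rewrite mulrDr mulr1 coefD coefMXn ltnNge leq_addr /=.
by rewrite addKn (nth_default _ (leq_trans sq (leq_addr _ _))) addr0.
Qed.

Lemma hamming_weight_XD1_multiple (gamma s : nat) (q : {poly R}) :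
  let f := q * ('X + 1) ^+ (2 ^ s - 2 ^ (s - gamma) + 1) in
  (gamma < s)%N -> (size f <= 2 ^ s)%N -> f != 0 ->
  (2 ^ gamma.+1 <= hamming_weight (2 ^ s) f)%N.
Proof.
elim: gamma s => [|g IH] [|s] //= gs.
  rewrite subnn => sf f0; apply: hamming_weight_ge2 => //.
  by rewrite expr1 hornerM hornerD hornerX hornerC -mulr2n (pcharf0 R2) mulr0.
rewrite subSS; set k := (2 ^ s - 2 ^ (s - g) + 1)%N.
have -> : (2 ^ s.+1 - 2 ^ (s - g) + 1 = k + 2 ^ s)%N.
  by rewrite expnS mul2n -addnn -addnBA ?leq_pexp2l ?leq_subr // -addnA addnC.
rewrite exprD mulrA exprXD1_pow2; set p := q * _ => sf f0.
have p0 : p != 0 by apply: contraNneq f0 => ->; rewrite mul0r.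
(* [R] may have zero divisors; a monic factor still makes sizes add up, which bounds [size p]. *)
have mX : ('X^(2 ^ s) + 1 : {poly R}) \is monic.
  by rewrite -polyC1 monicXnaddC // expn_gt0.
have sp : (size p <= 2 ^ s)%N.
  move: sf; rewrite size_Mmonic // -polyC1 size_XnaddC ?expn_gt0 //.
  by rewrite addnS /= expnS mul2n -addnn leq_add2r.
rewrite /hamming_weight (expnS 2 s) mul2n -addnn.
rewrite (sum_coef_mul_Xn_add1 (fun x => x != 0)) // expnS leq_mul2l.
exact: IH.
Qed.

(** The power is the product of ['X^(2 ^ j) + 1] for [t <= j < t + k], that is, the sum of the
    [2 ^ k] monomials ['X^(i * 2 ^ t)] with [i < 2 ^ k]. *)
Lemma sum_coef_scale_XD1_exp (phi : R -> nat) (c : R) (t k : nat) :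
  phi 0 = 0%N ->
  (\sum_(i < 2 ^ (t + k))
     phi ((c *: ('X + 1) ^+ (2 ^ (t + k) - 2 ^ t))`_i)%R = 2 ^ k * phi c)%N.
Proof.
move=> phi0; elim: k => [|k IH].
  rewrite addn0 subnn expr0 mul1n.
  have t0 : (0 < 2 ^ t)%N by rewrite expn_gt0.
  rewrite (bigD1 (Ordinal t0)) //= coefZ coef1 mulr1 big1 ?addn0 // => i ni.
  have i0 : (i == 0 :> nat) = false by apply: negPf.
  by rewrite coefZ coef1 i0 mulr0.
have le_t : (2 ^ t <= 2 ^ (t + k))%N by rewrite leq_pexp2l ?leq_addr.
rewrite addnS expnS mul2n -addnn -addnBA // [X in _ ^+ X]addnC exprD.
rewrite exprXD1_pow2 scalerAl sum_coef_mul_Xn_add1 ?IH ?mulnA ?expnS //.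
apply: leq_trans (size_scale_leq _ _) _.
rewrite -[1]opprK -polyCN size_exp_XsubC.
by rewrite ltn_subrL !expn_gt0.
Qed.

(** In characteristic two the modulus is [('X + 1) ^+ (2 ^ s)], a multiple of [('X + 1) ^+ alpha];
    reduction modulo it therefore preserves divisibility by that power. *)
Lemma principal_idealP (s alpha : nat) (c : cyclic_ring R (2 ^ s)) :
  (alpha <= 2 ^ s)%N ->
  principal_ideal (('qX + 1) ^+ alpha) c <->
  exists q : {poly R}, polyn c = q * ('X + 1) ^+ alpha.
Proof.
move=> le_as; have n0 : (0 < 2 ^ s)%N by rewrite expn_gt0.
have -> : ('qX + 1 : cyclic_ring R (2 ^ s)) = in_qpoly _ ('X + 1).
  by rewrite rmorphD rmorph1.
rewrite -rmorphXn /=; split=> [[r ->] | [q Dc]]; last first.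
  by exists (in_qpoly _ q); rewrite -rmorphM /= -Dc in_qpolyK.
rewrite -{1}[r]in_qpolyK -rmorphM /=; move: (polyn r) => {c}r.
rewrite mk_monic_cyclic //.
set p := _ * _; set h := 'X^_ - 1.
have mh : h \is monic by rewrite /h -polyC1 monicXnsubC.
have Dh : h = ('X + 1) ^+ (2 ^ s - alpha) * ('X + 1) ^+ alpha.
  by rewrite -exprD subnK // exprXD1_pow2 /h oppr_pchar2 // pchar_poly.
have := Pdiv.RingMonic.rdivp_eq mh p; set d := Pdiv.Ring.rdivp _ _ => Dp.
exists (r - d * ('X + 1) ^+ (2 ^ s - alpha)).
by rewrite mulrBl -mulrA -Dh -/p {2}Dp addrC addKr.
Qed.

End CharacteristicTwo.

Section LeeWeightBasis.

Variables (F : fieldExtType 'F_2) (m : nat) (B : m.-tuple F).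
Hypothesis basisB : basis_of {:F} B.

Lemma lee_weight_field_eq0 (y : F) : lee_weight_field B y = 0%N -> y = 0.
Proof.
move=> /eqP; rewrite cards_eq0 => /eqP E0.
rewrite (coord_basis basisB (memvf y)) big1 // => i _.
have : i \notin [set i | coord B i y == 1] by rewrite E0 inE.
(* A coordinate in ['F_2] other than 1 is 0. *)
rewrite inE; case: (coord B i y) => [[|[|//]] ?] h.
  2: by case/eqP: h; apply: val_inj.
by rewrite (_ : Ordinal _ = 0) ?scale0r //; apply: val_inj.
Qed.

Lemma lee_weight_field0 : lee_weight_field B 0 = 0%N.
Proof.
by apply/eqP; rewrite cards_eq0; apply/eqP/setP=> i; rewrite !inE linear0.
Qed.

Lemma lee_weight_field_basis (j : 'I_m) : lee_weight_field B (tnth B j) = 1%N.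
Proof.
rewrite /lee_weight_field (_ : finset _ = [set j]) ?cards1 //.
apply/setP=> i; rewrite !inE (tnth_nth 0) coord_free ?(basis_free basisB) //.
by rewrite [RHS]eq_sym; case: (j == i).
Qed.

Lemma lee_weight_eq0 (r : chain_ring F) : lee_weight B r = 0%N -> r = 0.
Proof.
(* The forms b, b + c, a + b + c are triangular: their vanishing gives b = 0, then c = 0, then a =
   0. *)
move=> /eqP; rewrite !addn_eq0 -andbA => /and3P[/eqP w0 /eqP w2 /eqP w1].
have r1 := lee_weight_field_eq0 w1.
have r2 := lee_weight_field_eq0 w2; rewrite r1 add0r in r2.
have r0 := lee_weight_field_eq0 w0; rewrite r1 r2 !addr0 in r0.
apply: val_inj; apply/polyP=> -[|[|[|i]]] //=; rewrite ?coef0 //.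
rewrite nth_default // (leq_trans (size_npoly r)) //.
by rewrite mk_monic_chain size_polyXn.
Qed.

Lemma lee_weight0 : lee_weight B 0 = 0%N.
Proof. by rewrite /lee_weight !coef0 !addr0 lee_weight_field0. Qed.

Lemma lee_weight_const (c : F) :
  lee_weight B (qpolyC _ c) = lee_weight_field B c.
Proof. by rewrite /lee_weight /= !coefC /= !addr0 lee_weight_field0 !addn0. Qed.

Lemma hamming_le_lee (n : nat) (c : cyclic_ring (chain_ring F) n) :
  (hamming_weight n (polyn c) <= lee_weight_word B c)%N.
Proof.
apply: leq_sum => i _; case: eqP => //= c0; rewrite lt0n.
by apply/eqP=> /lee_weight_eq0.
Qed.

End LeeWeightBasis.

(** Treats both ranges of the theorem at once: [gamma = 0] gives [1 <= alpha <= 2 ^ (s - 1)]. *)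
Lemma lee_distance_XD1_power (m s : nat) (F : fieldExtType 'F_2)
    (B : m.-tuple F) (alpha gamma : nat) :
  (0 < m)%N -> basis_of {:F} B -> (gamma < s)%N ->
  (2 ^ s - 2 ^ (s - gamma) + 1 <= alpha <= 2 ^ s - 2 ^ (s - gamma.+1))%N ->
  is_lee_distance B
    (principal_ideal (('qX + 1 : cyclic_ring (chain_ring F) (2 ^ s)) ^+ alpha))
    (2 ^ gamma.+1).
Proof.
move=> m0 basisB gs /andP[lo hi].
have R2 : 2 \in [pchar chain_ring F].
  by rewrite pchar_qpoly (pchar_lalg F) pchar_Fp.
have n0 : (0 < 2 ^ s)%N by rewrite expn_gt0.
have le_as : (alpha <= 2 ^ s)%N := leq_trans hi (leq_subr _ _).
split=> [|c /(principal_idealP R2 _ le_as)[q Dc] c0]; last first.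
  apply: leq_trans (hamming_le_lee basisB _).
  (* The lower bound on weights uses only the least exponent of the range. *)
  have Dc' : polyn c = q * ('X + 1) ^+ (alpha - (2 ^ s - 2 ^ (s - gamma) + 1))
                     * ('X + 1) ^+ (2 ^ s - 2 ^ (s - gamma) + 1).
    by rewrite -mulrA -exprD subnK.
  rewrite Dc'; apply: (hamming_weight_XD1_multiple R2) => //; rewrite -Dc' //.
  exact: size_cyclic.
set t := (s - gamma.+1)%N in hi.
have Ds : s = (t + gamma.+1)%N by rewrite subnK.
pose a : chain_ring F := qpolyC _ (tnth B (Ordinal m0)).
pose p : {poly chain_ring F} := a *: ('X + 1) ^+ (2 ^ s - 2 ^ t).
have sp : (size p <= 2 ^ s)%N.
  apply: leq_trans (size_scale_leq _ _) _.
  by rewrite -[1]opprK -polyCN size_exp_XsubC ltn_subrL !expn_gt0.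
pose c : cyclic_ring (chain_ring F) (2 ^ s) := in_qpoly _ p.
have Dc : polyn c = p.
  by rewrite in_qpoly_small // size_mk_monic_cyclic.
have wc : lee_weight_word B c = (2 ^ gamma.+1)%N.
  have := @sum_coef_scale_XD1_exp _ R2 (lee_weight B) a t gamma.+1.
  rewrite -Ds /lee_weight_word Dc => ->.
    by rewrite lee_weight_const lee_weight_field_basis // muln1.
  exact: lee_weight0.
exists c; split=> //.
  apply/(principal_idealP R2 _ le_as).
  exists (a *: ('X + 1) ^+ (2 ^ s - 2 ^ t - alpha)).
  by rewrite Dc -scalerAl -exprD subnK.
(* The word is nonzero because its weight is a power of two. *)
apply/eqP=> c0; have := wc; rewrite c0 /lee_weight_word big1 => [/esym/eqP|i _].
  by rewrite expn_eq0.
by rewrite coef0 lee_weight0.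
Qed.

Theorem theorem3p12 (m s : nat) (F : fieldExtType 'F_2) (B : m.-tuple F)
    (alpha : nat) (hm : (0 < m)%N) (hs : (0 < s)%N)
    (hF : \dim {:F} = m) (hB : trace_orthogonal_basis B)
    (halpha : (1 <= alpha <= 2 ^ s - 1)%N) :
  let C : cyclic_ring (chain_ring F) (2 ^ s) -> Prop :=
    principal_ideal (('qX + 1) ^+ alpha) in
  ((1 <= alpha <= 2 ^ (s - 1))%N -> is_lee_distance B C 2) /\
  (forall gamma : nat,
     (1 <= gamma <= s - 1)%N ->
     (2 ^ s - 2 ^ (s - gamma) + 1 <= alpha
        <= 2 ^ s - 2 ^ (s - gamma) + 2 ^ (s - gamma - 1))%N ->
     is_lee_distance B C (2 ^ (gamma + 1))).
Proof.
have [basisB _] := hB.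
have D (k : nat) : (0 < k)%N -> (2 ^ k = 2 ^ (k - 1) + 2 ^ (k - 1))%N.
  by case: k => // k _; rewrite subn1 expnS mul2n addnn.
split=> [ha | gamma hg ha].
  apply: (lee_distance_XD1_power (gamma := 0)) => //.
  by rewrite subn0 subnn [X in (_ <= _ <= X - _)%N]D // addnK.
have gs : (gamma < s)%N by case/andP: hg => _; rewrite subn1 -ltnS prednK.
rewrite addn1; apply: lee_distance_XD1_power => //.
have h : (0 < s - gamma)%N by rewrite subn_gt0.
case/andP: ha => -> /= /leq_trans; apply.
have le_2k : (2 ^ (s - gamma) <= 2 ^ s)%N by rewrite leq_pexp2l ?leq_subr.
have -> : (s - gamma.+1 = s - gamma - 1)%N by rewrite subnS subn1.
(* With [T = 2 ^ (s - gamma - 1)], the upper bounds agree: [n - (T + T) + T = n - T], where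
   [T + T <= n] keeps the subtraction exact. *)
move: le_2k; rewrite (D (s - gamma)%N h).
move: (2 ^ s)%N (2 ^ (s - gamma - 1))%N => n T le_TT.
by rewrite subnDA subnK // leq_subRL // (leq_trans (leq_addr _ _) le_TT).
Qed.
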